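(* Let $m,n\in\mathbb N$, let $D$ be a real diagonal $m\times m$ matrix and $B=\mathrm{diag}\{b_1,\dots,b_m\}$ with $b_k=\pm1$. Let $A\in\mathbb C^{n\times n}$ have its spectrum concentrated at one point $\lambda\in\mathbb C$, let $S(0)=S(0)^*\in\mathbb C^{n\times n}$ and $\Pi(0)\in\mathbb C^{n\times m}$ satisfy $AS(0)-S(0)A^*=\mathrm i\,\Pi(0)B\Pi(0)^*$, and let the initial potential be $\varrho\equiv0$, so that $\Pi(x)$ and $S(x)$, $x\ge0$, are determined by these initial values and $$\Pi_x=-\mathrm i A\Pi D,\qquad S_x=\Pi DB\Pi^*.$$ Put $\widetilde\varrho(x)=-B\Pi(x)^*S(x)^{-1}\Pi(x)$ at the points $x\ge 0$ where $S(x)$ is invertible. Then, on the set of these points, the system $$W_x=(\mathrm i zD-[D,\widetilde\varrho\,])W-\mathrm i zWD$$ is bispectral (in the sense defined in the context).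
   Context: Notation: $[P,Q]:=PQ-QP$; $^*$ is the conjugate transpose; $\mathrm i$ is the imaginary unit; $z\in\mathbb C$ is the spectral parameter. Bispectrality: the system $W_x=(\mathrm i zD-[D,\widetilde\varrho\,])W-\mathrm i zWD$ is called bispectral if it has an $m\times m$ matrix solution $W(x,z)$, holomorphic in $z$ outside a finite subset of $\mathbb C$ independent of $x$ and with $\det W(x,\cdot)\not\equiv0$ for each $x$, for which there exist a non-degenerate matrix linear differential operator $\mathcal B(z)$ in the variable $z$ (with coefficients independent of $x$), acting on $W$ from the right, and an $m\times m$ matrix function $\Theta(x)$ (independent of $z$; $\Theta\equiv0$ is allowed) such that $$W\,\mathcal B(z)=\Theta(x)\,W.$$ Here an operator of order $N\ge1$ acting from the right is given by $W\mathcal B(z)=\sum_{\ell=0}^N \frac{\partial^\ell W}{\partial z^\ell}\,b_\ell(z)$ with $m\times m$ matrix coefficients $b_\ell(z)$, and non-degenerate means that $\det b_N(z)\not\equiv0$. *)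

(* Defs.v *)
From HB Require Import structures.
From mathcomp Require Import all_boot all_order all_algebra.
From mathcomp Require Import spectral.
From mathcomp Require Import all_classical all_reals all_analysis.
From mathcomp Require Import complex.

Set Implicit Arguments.
Unset Strict Implicit.
Unset Printing Implicit Defensive.

Import Order.TTheory GRing.Theory Num.Theory.
Import numFieldNormedType.Exports.

Local Open Scope classical_set_scope.
Local Open Scope ring_scope.
Local Open Scope sesquilinear_scope.

(* R[i] packed as a field, whence its topology and its normed module structure
   over itself, which the library attaches to abstract numeric fields. *)
Definition cplx (R : realType) : numClosedFieldType := R[i].

Section MatrixCalculus.
Context {R : realType}.
Local Notation C := (cplx R).

(* The derivative of a matrix function of a real variable, relative to the set
   E on which the function is considered; it is one-sided at a boundary point
   of E, such as 0 in [0, +oo[. *)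
Definition is_xderiv p q (E : set R) (f : R -> 'M[C]_(p, q)) (x : R)
    (l : 'M[C]_(p, q)) : Prop :=
  forall i j,
    ((f y i j - f x i j) / ((y - x)%:C%C : C)) @[y --> within E x^'] --> l i j.

(* [derivable _ z 1] is complex differentiability, the scalars being C. *)
Definition mx_holomorphic p q (U : set C) (f : C -> 'M[C]_(p, q)) : Prop :=
  forall z, U z -> forall i j, derivable (fun w => f w i j) z 1.

Definition mx_zderiv p q (l : nat) (f : C -> 'M[C]_(p, q)) (z : C) :
    'M[C]_(p, q) :=
  \matrix_(i, j) derive1n l (fun w => f w i j) z.

Definition right_op m (N : nat) (b : nat -> C -> 'M[C]_m) (W : C -> 'M[C]_m)
    (z : C) : 'M[C]_m :=
  \sum_(l < N.+1) mx_zderiv l W z *m b l z.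

Definition mx_commutator m (P Q : 'M[C]_m) : 'M[C]_m := P *m Q - Q *m P.

(* Bispectrality, for x in X, of
     W_x = (i z D - [D, rho]) W - i z W D.
   The finite set F contains the singularities in z both of W and of the
   coefficients b; the identities in z are required off F.  The coefficients
   must be holomorphic off F: if they could be arbitrary functions of z,
   det b_N could be nonzero at a single point, and the notion would be void. *)
Definition bispectral m (X : set R) (D : 'M[C]_m) (rho : R -> 'M[C]_m) : Prop :=
  exists (F : seq C) (W : R -> C -> 'M[C]_m),
    let U := [set z : C | z \notin F] in
    [/\ forall x z, X x -> U z ->
          is_xderiv X (W ^~ z) x
            ((('i * z) *: D - mx_commutator D (rho x)) *m W x z
             - ('i * z) *: (W x z *m D)),
        forall x, X x -> mx_holomorphic U (W x),
        forall x, X x -> exists2 z, U z & \det (W x z) != 0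
      & exists (N : nat) (b : nat -> C -> 'M[C]_m) (Theta : R -> 'M[C]_m),
          [/\ (1 <= N)%N,
              forall l, (l <= N)%N -> mx_holomorphic U (b l),
              exists2 z, U z & \det (b N z) != 0
            & forall x z, X x -> U z ->
                right_op N b (W x) z = Theta x *m W x z] ].

End MatrixCalculus.

(* Main.v *)
Require Import Defs.
From HB Require Import structures.
From mathcomp Require Import all_boot all_order all_algebra.
From mathcomp Require Import spectral.
From mathcomp Require Import all_classical all_reals all_analysis.
From mathcomp Require Import complex ring.

Set Implicit Arguments.
Unset Strict Implicit.
Unset Printing Implicit Defensive.

Import Order.TTheory GRing.Theory Num.Theory.
Import numFieldNormedType.Exports.

Local Open Scope classical_set_scope.
Local Open Scope ring_scope.
Local Open Scope sesquilinear_scope.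

(** The solution is the Darboux matrix of the trivial potential,
      W(x, z) = I - i B Pi(x)^* S(x)^-1 (A - z)^-1 Pi(x).
    The Sylvester identity A S - S A^* = i Pi B Pi^* holds at x = 0 by
    hypothesis and both of its sides have the same x-derivative, so it holds for
    all x >= 0 ([gram_identity], which rests on [is_xderiv0_cst]).  Given it,
    differentiating W and using A (A - z)^-1 = 1 + z (A - z)^-1 yields the system
    by pure matrix algebra ([darboux_identity], [darboux_mx_ode]).

    Let a be the only eigenvalue of the n x n matrix A and t = z - a.  Then A - a
    is nilpotent, so its Neumann series stops and W is a polynomial of degree at
    most n in 1/t with constant term I:
      W(x, z) = I + W_1(x) t^-1 + ... + W_n(x) t^-n.
    Such a W is holomorphic off a, and det W(x, .) is not identically 0 because
    it tends to 1 as t tends to infinity ([det_laurent_neq0]).  The Euler operator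
    t d/dt multiplies t^-j by -j, whatever the matrix coefficient in front of it
    is; hence the scalar operator with x-independent coefficients
      (t d/dt) (t d/dt + 1) ... (t d/dt + n)
    kills W ([darboux_mx_annihilator]).  Its order is n + 1 and its leading
    coefficient t^(n+1) I is invertible off a, so the system is bispectral with
    Theta = 0 and with a as the only singular point. *)

(** * Matrix algebra *)

(** Over an algebraically closed field the characteristic polynomial splits, so
    it is a power of X - a, and Cayley-Hamilton concludes. *)
Lemma single_eigenvalue_nilpotent (F : closedFieldType) n (A : 'M[F]_n.+1) a :
  (forall b, eigenvalue A b -> b = a) -> (A - a%:M) ^+ n.+1 = 0.
Proof.
move=> eigA.
have [r] := closed_field_poly_normal (char_poly A).
rewrite (monicP (char_poly_monic A)) scale1r => cpA.
have ra : r = nseq n.+1 a.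
  have: all (pred1 a) r.
    apply/allP => b br /=; apply/eqP/eigA.
    by rewrite eigenvalue_root_char cpA root_prod_XsubC.
  move/all_pred1P ->; congr nseq.
  by have := size_char_poly A; rewrite cpA size_prod_XsubC => -[].
have := Cayley_Hamilton A.
rewrite cpA ra big_nseq iter_mulr_1 rmorphXn rmorphB /= horner_mx_X horner_mx_C.
exact.
Qed.

(** For N nilpotent this is the inverse of N - t: the Neumann series of
    - t^-1 (1 - t^-1 N)^-1 is a finite sum. *)
Definition nilpotent_resolvent (F : fieldType) n (N : 'M[F]_n.+1) (t : F) :=
  - \sum_(k < n.+1) t ^- k.+1 *: N ^+ k.

Lemma nilpotent_resolventP (F : fieldType) n (N : 'M[F]_n.+1) t :
  N ^+ n.+1 = 0 -> t != 0 ->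
  N * nilpotent_resolvent N t = 1 + t *: nilpotent_resolvent N t.
Proof.
move=> Nn t0; apply/eqP; rewrite -subr_eq; apply/eqP.
rewrite /nilpotent_resolvent mulrN scalerN opprK mulr_sumr scaler_sumr.
rewrite addrC -sumrB.
have step (k : nat) : t *: (t ^- k.+1 *: N ^+ k) - N * (t ^- k.+1 *: N ^+ k)
    = - (t ^- k.+1 *: N ^+ k.+1 - t ^- k *: N ^+ k).
  rewrite opprB.
  by rewrite -scalerAr -exprS scalerA (exprS t) invfM mulrA mulfV // mul1r.
under eq_bigr do rewrite step.
rewrite sumrN -(big_mkord xpredT (fun k : nat =>
  t ^- k.+1 *: N ^+ k.+1 - t ^- k *: N ^+ k)) telescope_sumr //.
by rewrite Nn scaler0 sub0r opprK !expr0 invr1 scale1r.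
Qed.

Lemma nilpotent_resolvent_comm (F : fieldType) n (N : 'M[F]_n.+1) t :
  nilpotent_resolvent N t * N = N * nilpotent_resolvent N t.
Proof.
rewrite /nilpotent_resolvent mulrN mulNr mulr_sumr mulr_suml; congr (- _).
by apply: eq_bigr => k _; rewrite -scalerAr -scalerAl -exprS -exprSr.
Qed.

(** The algebra behind the Darboux transformation.  P' and A' stand for the
    adjoints of P and A, and Q for the resolvent of A at z.  The left-hand side
    is the derivative of W = 1 - i B P' S^-1 Q P given by the product rule when
    dP = -i A P D, dP' = i D P' A' and dS = P D B P'.  The identity
    A S - S A' = i P B P' moves A' across S^-1 to the resolvent, at the cost of
    a term in rho, and the resolvent absorbs A. *)
Lemma darboux_identity (F : comUnitRingType) m n (i z : F) (D B : 'M[F]_m)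
    (A A' S Q : 'M[F]_n) (P : 'M[F]_(n, m)) (P' : 'M[F]_(m, n))
    (X := invmx S) (G := B *m P' *m X) (rho := - (G *m P))
    (K := i *: (G *m Q *m P)) (W := 1%:M - K) :
  i * i = -1 -> S \in unitmx -> D *m B = B *m D ->
  A *m Q = 1%:M + z *: Q -> Q *m A = 1%:M + z *: Q ->
  A *m S - S *m A' = i *: (P *m B *m P') ->
  - i *: ((B *m (i *: (D *m P' *m A')) *m X
            + B *m P' *m - (X *m (P *m D *m B *m P') *m X)) *m Q *m P
          + G *m Q *m (- i *: (A *m P *m D)))
  = ((i * z) *: D - (D *m rho - rho *m D)) *m W - (i * z) *: (W *m D).
Proof.
move=> ii Su DB AQ QA id0.
have A'X : A' *m X = X *m A - i *: (X *m P *m B *m P' *m X).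
  have : X *m (A *m S - S *m A') *m X = X *m (i *: (P *m B *m P')) *m X.
    by rewrite id0.
  rewrite mulmxBr mulmxBl !mulmxA mulVmx // mul1mx mulmxK // -scalemxAr -scalemxAl.
  by rewrite !mulmxA => <-; rewrite opprB addrC subrK.
have T1 : B *m (i *: (D *m P' *m A')) *m X *m Q *m P
    = i *: (D *m G *m P + z *: (D *m G *m Q *m P)
            - i *: (D *m G *m P *m G *m Q *m P)).
  rewrite -scalemxAr -!scalemxAl !mulmxA -DB -(mulmxA _ A') A'X.
  rewrite mulmxBr mulmxBl mulmxBl !mulmxA -(mulmxA _ A) AQ mulmxDr mulmx1.
  by rewrite mulmxDl -!scalemxAr -!scalemxAl !mulmxA.
have T3 : G *m Q *m (- i *: (A *m P *m D))
    = - i *: (G *m P *m D + z *: (G *m Q *m P *m D)).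
  rewrite -scalemxAr !mulmxA -(mulmxA _ Q A) QA mulmxDr mulmx1 !mulmxDl.
  by rewrite -!scalemxAr -!scalemxAl.
rewrite !mulmxDl T1 T3 /W /K /rho !mulmxN !mulNmx.
rewrite !(mulmxDl, mulmxDr, mulmxN, mulNmx, mulmx1, mul1mx).
rewrite -!(scalemxAl, scalemxAr) !mulmxA -/G.
(* what remains is a scalar identity in each entry, modulo i * i = -1 *)
do !match goal with |- context [?M *m ?N] => move: (M *m N) => ? end.
apply/matrixP => a b; rewrite !mxE.
by ring: ii.
Qed.

(** * Entrywise limits and x-derivatives of matrix functions *)

Section MatrixLimits.
Context {R : realType} {T : Type} {F : set_system T} {FF : Filter F}.
Local Notation C := (cplx R).

Definition mx_cvg p q (f : T -> 'M[C]_(p, q)) (l : 'M[C]_(p, q)) :=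
  forall i j, f t i j @[t --> F] --> l i j.

Lemma mx_cvg_cst p q (l : 'M[C]_(p, q)) : mx_cvg (fun=> l) l.
Proof. by move=> i j; exact: cvg_cst. Qed.

Lemma mx_cvg_near_eq p q (f g : T -> 'M[C]_(p, q)) a :
  (\forall t \near F, f t = g t) -> mx_cvg f a -> mx_cvg g a.
Proof.
move=> fg fa i j; apply: cvg_trans (fa i j); apply: near_eq_cvg.
by apply: filterS fg => t ->.
Qed.

Lemma mx_cvgD p q (f g : T -> 'M[C]_(p, q)) a b :
  mx_cvg f a -> mx_cvg g b -> mx_cvg (fun t => f t + g t) (a + b).
Proof.
move=> fa gb i j; rewrite mxE.
under eq_cvg do rewrite mxE.
exact: cvgD (fa i j) (gb i j).
Qed.

Lemma mx_cvgZ p q (c : T -> C) (f : T -> 'M[C]_(p, q)) (k : C) a :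
  c t @[t --> F] --> k -> mx_cvg f a -> mx_cvg (fun t => c t *: f t) (k *: a).
Proof.
move=> ck fa i j; rewrite mxE.
under eq_cvg do rewrite mxE.
exact: cvgM ck (fa i j).
Qed.

Lemma mx_cvgM p q r (f : T -> 'M[C]_(p, q)) (g : T -> 'M[C]_(q, r)) a b :
  mx_cvg f a -> mx_cvg g b -> mx_cvg (fun t => f t *m g t) (a *m b).
Proof.
move=> fa gb i j; rewrite mxE.
under eq_cvg do rewrite mxE.
apply: cvg_big => [|k _]; first exact: add_continuous.
exact: cvgM (fa i k) (gb k j).
Qed.

Lemma mx_cvg_det n (f : T -> 'M[C]_n) a :
  mx_cvg f a -> \det (f t) @[t --> F] --> \det a.
Proof.
move=> fa; apply: cvg_big => [|s _]; first exact: add_continuous.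
apply: cvgM; first exact: cvg_cst.
by apply: cvg_big => [|i _]; [exact: mul_continuous | exact: fa].
Qed.

Lemma mx_cvg_adj n (f : T -> 'M[C]_n) a :
  mx_cvg f a -> mx_cvg (fun t => \adj (f t)) (\adj a).
Proof.
move=> fa i j; rewrite mxE.
under eq_cvg do rewrite mxE.
apply: cvgM; first exact: cvg_cst.
apply: mx_cvg_det => k l; rewrite !mxE.
under eq_cvg do rewrite !mxE.
exact: fa.
Qed.

(** By Cramer's rule the inverse is a rational function of the entries. *)
Lemma mx_cvg_inv n (f : T -> 'M[C]_n) a : a \in unitmx ->
  (\forall t \near F, f t \in unitmx) -> mx_cvg f a ->
  mx_cvg (fun t => invmx (f t)) (invmx a).
Proof.
move=> ua uf fa.
apply: (@mx_cvg_near_eq _ _ (fun t => (\det (f t))^-1 *: \adj (f t))).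
  by apply: filterS uf => t uft; rewrite /invmx uft.
rewrite /invmx ua; apply: mx_cvgZ; last exact: mx_cvg_adj.
by apply: cvgV; [rewrite -unitfE | exact: mx_cvg_det].
Qed.

Lemma cvg_conjC (f : T -> C) (a : C) :
  f t @[t --> F] --> a -> (f t)^* @[t --> F] --> a^*.
Proof.
move=> /cvgrPdist_lt fa; apply/cvgrPdist_lt => e /fa.
by apply: filterS => t; rewrite -rmorphB norm_conjC.
Qed.

Lemma mx_cvg_conjT p q (f : T -> 'M[C]_(p, q)) a :
  mx_cvg f a -> mx_cvg (fun t => (f t)^t*) (a^t*).
Proof.
move=> fa i j; rewrite !mxE.
under eq_cvg do rewrite !mxE.
exact/cvg_conjC/fa.
Qed.

End MatrixLimits.
Arguments mx_cvg {R T} F [p q].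
Arguments mx_cvg_cst {R T F FF p q} l.

Section RealDerivative.
Context {R : realType}.
Local Notation C := (cplx R).
Implicit Types (E : set R) (x : R).

(** Turns the entrywise definition into a limit of a matrix-valued difference
    quotient, so that the product rule becomes a computation in matrix algebra. *)
Lemma is_xderivP p q E (f : R -> 'M[C]_(p, q)) x l :
  is_xderiv E f x l <->
  mx_cvg (within E x^') (fun y => ((y - x)%:C%C : C)^-1 *: (f y - f x)) l.
Proof.
by split=> fl i j; have := fl i j; apply: cvg_trans; apply: near_eq_cvg;
  apply: nearW => y; rewrite !mxE mulrC.
Qed.

Lemma cvg_real_complex x : ((y - x)%:C%C : C) @[y --> nbhs x] --> (0 : C).
Proof.
apply/cvgrPdist_lt => e e0.
have e_real : ((complex.Re e)%:C%C : C) = e by apply: RRe_real; apply: gtr0_real.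
have : 0 < complex.Re e by rewrite -ltcR e_real.
have := @cvgr_dist_lt _ _ _ _ _ id x cvg_id => /[apply].
apply: filterS => y; rewrite distrC sub0r normrN.
rewrite -ltcR e_real; congr (_ < _).
by rewrite normc_def /= expr0n addr0 sqrtr_sqr.
Qed.

Lemma is_xderiv_cvg p q E (f : R -> 'M[C]_(p, q)) x l :
  is_xderiv E f x l -> mx_cvg (within E x^') f (f x).
Proof.
move/is_xderivP => fl.
have to0 : ((y - x)%:C%C : C) @[y --> within E x^'] --> (0 : C).
  by do 2! apply: cvg_within_filter; exact: cvg_real_complex.
rewrite -[f x]addr0 -(scale0r l).
apply: mx_cvg_near_eq (mx_cvgD (mx_cvg_cst (f x)) (mx_cvgZ to0 fl)).
near=> y; rewrite scalerA mulfV ?scale1r ?subrKC //.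
have : y != x by near: y; exact: cvg_within (near_withinT _ _).
by rewrite fmorph_eq0 subr_eq0.
Unshelve. all: by end_near. Qed.


Lemma is_xderiv_subset p q E E' (f : R -> 'M[C]_(p, q)) x l : E `<=` E' ->
  is_xderiv E' f x l -> is_xderiv E f x l.
Proof.
move=> EE' fl i j; apply: cvg_trans (fl i j).
by apply: cvg_app; exact: within_subset.
Qed.

Lemma is_xderiv_cst p q E (a : 'M[C]_(p, q)) x : is_xderiv E (fun=> a) x 0.
Proof.
move=> i j; rewrite mxE.
under eq_cvg do rewrite subrr mul0r.
exact: cvg_cst.
Qed.

Lemma is_xderivD p q E (f g : R -> 'M[C]_(p, q)) x a b :
  is_xderiv E f x a -> is_xderiv E g x b ->
  is_xderiv E (fun y => f y + g y) x (a + b).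
Proof.
move=> /is_xderivP fa /is_xderivP gb; apply/is_xderivP.
apply: mx_cvg_near_eq (mx_cvgD fa gb).
by apply: nearW => y; rewrite -scalerDr opprD addrACA.
Qed.

Lemma is_xderivM p q r E (f : R -> 'M[C]_(p, q)) (g : R -> 'M[C]_(q, r)) x a b :
  is_xderiv E f x a -> is_xderiv E g x b ->
  is_xderiv E (fun y => f y *m g y) x (a *m g x + f x *m b).
Proof.
move=> fa gb; have gx := is_xderiv_cvg gb.
move/is_xderivP: fa => fa; move/is_xderivP: gb => gb; apply/is_xderivP.
apply: mx_cvg_near_eq (mx_cvgD (mx_cvgM fa gx) (mx_cvgM (mx_cvg_cst (f x)) gb)).
apply: nearW => y.
rewrite -scalemxAl -scalemxAr -scalerDr mulmxBl mulmxBr.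
by rewrite [X in _ *: X]addrA subrK.
Qed.

Lemma is_xderivMl p q r E (c : 'M[C]_(p, q)) (f : R -> 'M[C]_(q, r)) x a :
  is_xderiv E f x a -> is_xderiv E (fun y => c *m f y) x (c *m a).
Proof.
by move=> fa; have := is_xderivM (@is_xderiv_cst _ _ E c x) fa; rewrite mul0mx add0r.
Qed.

Lemma is_xderivMr p q r E (f : R -> 'M[C]_(p, q)) (c : 'M[C]_(q, r)) x a :
  is_xderiv E f x a -> is_xderiv E (fun y => f y *m c) x (a *m c).
Proof.
by move=> fa; have := is_xderivM fa (@is_xderiv_cst _ _ E c x); rewrite mulmx0 addr0.
Qed.

Lemma is_xderivZ p q E (c : C) (f : R -> 'M[C]_(p, q)) x a :
  is_xderiv E f x a -> is_xderiv E (fun y => c *: f y) x (c *: a).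
Proof.
move=> /is_xderivP fa; apply/is_xderivP.
apply: mx_cvg_near_eq (mx_cvgZ (cvg_cst c) fa).
by apply: nearW => y; rewrite -scalerBr !scalerA mulrC.
Qed.

(** The difference quotient of f^-1 is - f(y)^-1 ((f y - f x) / (y - x)) f(x)^-1
    and f(y)^-1 tends to f(x)^-1. *)
Lemma is_xderiv_inv n E (f : R -> 'M[C]_n) x a : E `<=` [set y | f y \in unitmx] ->
  E x -> is_xderiv E f x a ->
  is_xderiv E (fun y => invmx (f y)) x (- (invmx (f x) *m a *m invmx (f x))).
Proof.
move=> Eu Ex fa; have fx := is_xderiv_cvg fa.
move/is_xderivP: fa => fa; apply/is_xderivP.
have ux := Eu _ Ex.
have u : \forall y \near within E x^', f y \in unitmx.
  by apply: filterS (near_withinT E _) => y /Eu.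
rewrite -mulmxN; apply: mx_cvg_near_eq
  (mx_cvgM (mx_cvgM (mx_cvg_inv ux u fx) fa) (mx_cvg_cst (- invmx (f x)))).
apply: filterS u => y uy.
rewrite -scalemxAr -scalemxAl; congr (_ *: _).
by rewrite mulmxN mulmxBr mulmxBl mulVmx // mul1mx mulmxK // opprB.
Qed.

Lemma is_xderiv_conjT p q E (f : R -> 'M[C]_(p, q)) x a :
  is_xderiv E f x a -> is_xderiv E (fun y => (f y)^t*) x (a^t*).
Proof.
move=> /is_xderivP fa; apply/is_xderivP.
apply: mx_cvg_near_eq (mx_cvg_conjT fa); apply: nearW => y.
apply/matrixP => i j; rewrite !mxE rmorphM fmorphV -rmorphB; congr (_^-1 * _).
by apply: conj_Creal; apply/complex_realP; exists (y - x).
Qed.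

End RealDerivative.
Arguments is_xderiv_cst {R p q E} a x.
Arguments is_xderivMl {R p q r E} c [f x a] fa : rename.
Arguments is_xderivMr {R p q r E} [f] c [x a] fa : rename.
Arguments is_xderivZ {R p q E} c [f x a] fa : rename.

(** The mean value theorem on [0, x]: the bound on the slopes gives a zero
    derivative inside and one-sided continuity at the end point 0. *)
Lemma zero_slope_cst (R : realType) (g : R -> R) :
  (forall x e : R, 0 <= x -> 0 < e ->
    \forall y \near x, 0 <= y -> `|g y - g x| <= e * `|y - x|) ->
  forall x, 0 <= x -> g x = g 0.
Proof.
move=> slope x; rewrite le_eqVlt => /predU1P[<- //|x0].
have [| | c _] := @MVT R g (cst 0) 0 x x0.
- move=> z /[!in_itv]/= /andP[z0 _].
  have q0 : h^-1 *: ((g \o shift z) (h *: 1) - g z) @[h --> 0^'] --> (0 : R).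
    apply/cvgrPdist_le => e e0.
    have near_z (P : set R) : (\near z, P z) -> \forall h \near 0^', P (h + z).
      move=> Pz; apply: cvg_within.
      suff : h + z @[h --> (0 : R)] --> z by apply.
      by rewrite -[X in _ --> X]add0r; apply: cvgD; [exact: cvg_id | exact: cvg_cst].
    near=> h; have h0 : h != 0 by near: h; exact: nbhs_dnbhs_neq.
    rewrite sub0r normrN normrM normfV ler_pdivrMl ?normr_gt0 //.
    rewrite mulrC /= [h *: 1]mulr1.
    have : 0 < h + z by near: h; exact: (near_z [set y | 0 < y] (lt_nbhsr z0)).
    have : 0 <= h + z -> `|g (h + z) - g z| <= e * `|h + z - z|.
      near: h.
      exact: (near_z [set y | 0 <= y -> `|g y - g z| <= e * `|y - z|]
                (slope z e (ltW z0) e0)).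
    by move=> + /ltW hz; rewrite addrK => /(_ hz).
  by apply: DeriveDef; [apply/cvg_ex; exists 0 | exact: cvg_lim].
- apply/subspace_continuousP => z /=; rewrite in_itv /= => /andP[z0 _].
  apply/cvgrPdist_lt => e e0; rewrite near_withinE.
  near=> y; rewrite /= in_itv /= => /andP[y0 _].
  rewrite distrC (le_lt_trans (_ : _ <= 1 * `|y - z|)) //.
    by move: y0; near: y; exact: slope.
  by rewrite mul1r distrC; near: y; exact: cvgr_dist_lt.
by rewrite mul0r => /eqP; rewrite subr_eq0 => /eqP.
Unshelve. all: by end_near. Qed.

(** Reduces to the real case: the real part of an entry has vanishing slope
    since |Re w| <= |w|, and Im w = - Re (i w). *)
Lemma is_xderiv0_cst (R : realType) p q (f : R -> 'M[cplx R]_(p, q)) :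
  (forall x, 0 <= x -> is_xderiv [set y | 0 <= y] f x 0) ->
  forall x, 0 <= x -> f x = f 0.
Proof.
have Re_cst (g : R -> 'M[cplx R]_(p, q)) i j :
  (forall x, 0 <= x -> is_xderiv [set y | 0 <= y] g x 0) ->
  forall x, 0 <= x -> complex.Re (g x i j) = complex.Re (g 0 i j).
  move=> g0; apply: zero_slope_cst => x e x0 e0.
  have := g0 _ x0 i j; rewrite mxE => /cvgrPdist_lt /(_ e%:C%C).
  rewrite ltcR => /(_ e0); rewrite !near_withinE.
  apply: filterS => y gy y0; have [->|yx] := eqVneq y x.
    by rewrite !subrr normr0 mulr0.
  have {gy} := gy yx y0; rewrite sub0r normrN normrM normfV.
  have -> : `|((y - x)%:C%C : cplx R)| = `|y - x|%:C%C.
    by rewrite normc_def /= expr0n addr0 sqrtr_sqr.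
  rewrite ltr_pdivrMr; last by rewrite ltcR normr_gt0 subr_eq0.
  move=> /(le_lt_trans (normc_ge_Re _)).
  by rewrite -rmorphM ltcR raddfB => /ltW.
move=> f0 x x0; apply/matrixP => i j.
have imul0 y : 0 <= y -> is_xderiv [set y | 0 <= y] (fun y => 'i *: f y) y 0.
  by move=> y0; rewrite -(scaler0 _ 'i); apply/is_xderivZ/f0.
apply/eqP; rewrite eq_complex (Re_cst f) // eqxx /=.
have := Re_cst _ i j imul0 x x0; rewrite !mxE ![_ * f _ _ _]mulrC.
by rewrite -complexiE !ReiNIm => /oppr_inj ->.
Qed.

(** * Scalar Laurent polynomials in z and the Euler operator *)

(** The falling factorial (-j) (-j - 1) ... (-j - l + 1), that is, the factor in
    (d/dt)^l t^-j = deriv_coef j l * t^(-j - l). *)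
Definition deriv_coef (F : fieldType) (j l : nat) : F :=
  \prod_(i < l) - (j + i)%:R.

Lemma deriv_coefS (F : fieldType) j l :
  deriv_coef F j l.+1 = - (j + l)%:R * deriv_coef F j l.
Proof. by rewrite /deriv_coef big_ord_recr mulrC. Qed.

(** The numbers c l are the coefficients of
      (t d/dt) (t d/dt + 1) ... (t d/dt + N - 1) = sum_l c l t^l (d/dt)^l,
    and the identity compares the two sides on t^-j.  In the induction, composing
    with t d/dt + N sends t^l (d/dt)^l to
    t^(l+1) (d/dt)^(l+1) + (N + l) t^l (d/dt)^l. *)
Lemma euler_operator_coef (F : fieldType) (N : nat) :
  exists c : nat -> F, c N = 1 /\
    forall j, \sum_(l < N.+1) c l * deriv_coef F j l = \prod_(k < N) (k%:R - j%:R).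
Proof.
elim: N => [|N [c [cN cE]]].
  by exists (fun=> 1); split=> // j; rewrite big_ord1 big_ord0 /deriv_coef big_ord0 mulr1.
exists (fun l => (if l is l'.+1 then c l' else 0)
                 + (if (l <= N)%N then (N + l)%:R * c l else 0)); split.
  by rewrite ltnn addr0.
move=> j; under eq_bigr do rewrite mulrDl.
rewrite big_split /= big_ord_recl /= mul0r add0r.
rewrite [X in _ + X]big_ord_recr /= ltnn mul0r addr0 -big_split /=.
rewrite [RHS]big_ord_recr /= -cE mulr_suml; apply: eq_bigr => l _.
have lN : (l <= N)%N by rewrite -ltnS.
by rewrite lN deriv_coefS !natrD; ring.
Qed.

Section Laurent.
Context {K : numFieldType}.
Implicit Type a : K.

Lemma derivable_shift_monomial a c l (z : K) :
  derivable (fun x => c * (x - a) ^+ l) z 1.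
Proof.
have -> : (fun x => c * (x - a) ^+ l) = c \*: ((fun x : K => x - a) ^+ l).
  by apply/funext => x; rewrite /= fctE.
exact/derivableZ/derivableX.
Qed.

Lemma near_neq (z a : K) : z != a -> \forall x \near z, x != a.
Proof.
move=> za; have za0 : 0 < `|z - a| by rewrite normr_gt0 subr_eq0.
near=> x; have : `|z - x| < `|z - a| by near: x; exact: cvgr_dist_lt.
by apply: contraTneq => ->; rewrite ltxx.
Unshelve. all: by end_near. Qed.

Lemma is_derive_negpow a j (z : K) : z != a ->
  is_derive z 1 (fun x => (x - a) ^- j) (- j%:R * (z - a) ^- j.+1).
Proof.
move=> za; have za0 : z - a != 0 by rewrite subr_eq0.
have sD : is_derive z 1 (fun x : K => x - a) 1.
  by rewrite -[X in is_derive _ _ _ X]subr0; apply: is_deriveB.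
have vD : is_derive z 1 (fun x => (x - a)^-1) (- (z - a) ^- 2).
  have df : derivable (fun x : K => x - a) z 1 by [].
  apply: DeriveDef; first exact: derivableV.
  by rewrite deriveV // derive_val /GRing.scale /= mulr1.
have := @is_deriveX _ _ (fun x => (x - a)^-1) j _ _ _ vD.
have -> : (fun x : K => (x - a)^-1) ^+ j = fun x => (x - a) ^- j.
  by apply/funext => x; rewrite fctE exprVn.
congr is_derive; rewrite /GRing.scale /= mulrN mulNr -mulrA; congr (- _).
case: j => [|j]; first by rewrite !mul0r.
by rewrite exprVn -invfM -exprD addn2.
Qed.

Lemma is_derive_laurent a n (w : nat -> K) (e : nat -> nat) z : z != a ->
  is_derive z 1 (fun x => \sum_(j < n) w j * (x - a) ^- e j)
    (\sum_(j < n) w j * (- (e j)%:R * (z - a) ^- (e j).+1)).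
Proof.
move=> za.
have -> : (fun x => \sum_(j < n) w j * (x - a) ^- e j)
    = \sum_(j < n) (w j \*: (fun x : K => (x - a) ^- e j)).
  by apply/funext => x; rewrite fct_sumE.
by apply: is_derive_sum => j; apply: is_deriveZ; exact: is_derive_negpow.
Qed.

Lemma derive1n_laurent a n (w : nat -> K) l z : z != a ->
  derive1n l (fun x => \sum_(j < n) w j * (x - a) ^- j) z
  = \sum_(j < n) (deriv_coef K j l * w j) * (z - a) ^- (j + l).
Proof.
elim: l z => [|l IH] z za.
  rewrite derive1n0; apply: eq_bigr => j _.
  by rewrite /deriv_coef big_ord0 mul1r addn0.
rewrite derive1nS derive1E.
have near_za := near_neq za.
rewrite (near_eq_derive (g := fun x => \sum_(j < n)
  (deriv_coef K j l * w j) * (x - a) ^- (j + l))); last first.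
  by apply: filterS near_za => x /IH.
have := is_derive_laurent n (fun j => deriv_coef K j l * w j) (addn^~ l) za.
move=> /(@derive_val _ _ _ _ _ _ _) ->; apply: eq_bigr => j _.
by rewrite addnS deriv_coefS; ring.
Qed.

End Laurent.

Lemma poly_exists_nonroot (F : numDomainType) (p : {poly F}) :
  p != 0 -> exists s, ~~ root p s.
Proof.
move=> p0; pose rs : seq F := [seq i%:R | i <- iota 0 (size p)].
suff /allPn[s _ ps] : ~~ all (root p) rs by exists s.
have rs_uniq : uniq rs by rewrite map_inj_uniq ?iota_uniq //; exact: mulrIn.
apply/negP => /(max_poly_roots p0) /(_ rs_uniq).
by rewrite size_map size_iota ltnn.
Qed.

(** In the variable s = (z - a)^-1 the determinant is a polynomial equal to 1 at
    s = 0.  It is multiplied by 'X so that a non-root is nonzero, hence comes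
    from some z. *)
Lemma det_laurent_neq0 (F : numFieldType) m n (M : 'I_n.+1 -> 'M[F]_m) (a : F) :
  M ord0 = 1%:M ->
  exists2 z, z != a & \det (\sum_(k < n.+1) (z - a) ^- k *: M k) != 0.
Proof.
move=> M0.
pose P : 'M[{poly F}]_m := \sum_(k < n.+1) 'X^k *: map_mx polyC (M k).
have Ps s : map_mx (horner_eval s) P = \sum_(k < n.+1) s ^+ k *: M k.
  rewrite /P raddf_sum /=; apply: eq_bigr => k _.
  apply/matrixP => i j; rewrite !mxE /horner_eval.
  by rewrite hornerM hornerXn hornerC.
have detP s : (\det P).[s] = \det (\sum_(k < n.+1) s ^+ k *: M k).
  by rewrite -Ps det_map_mx.
have XP0 : 'X * \det P != 0.
  rewrite mulf_neq0 ?polyX_eq0 //; apply/eqP => P0.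
  have := detP 0; rewrite P0 horner0 big_ord_recl expr0 scale1r M0 big1 => [|k _].
    by rewrite addr0 det1 => /esym/eqP; rewrite oner_eq0.
  by rewrite expr0n scale0r.
have [s] := poly_exists_nonroot XP0.
rewrite rootM rootX negb_or => /andP[s0 Ps0].
exists (a + s^-1); first by rewrite -subr_eq0 addrC addKr invr_eq0.
rewrite rootE detP in Ps0; rewrite addrC addKr.
by under eq_bigr do rewrite exprVn invrK.
Qed.

Lemma diag_mx_commute (F : comPzRingType) m (D B : 'M[F]_m) :
  is_diag_mx D -> is_diag_mx B -> D *m B = B *m D.
Proof. by move=> /diag_mxP[d ->] /diag_mxP[b ->]; exact: diag_mxC. Qed.

Lemma real_diag_mx_adj (F : numClosedFieldType) m (D : 'M[F]_m) :
  is_diag_mx D -> D \is a mxOver Num.real -> D^t* = D.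
Proof.
move=> /diag_mxP[d ->] /mxOverP Dr; apply/matrixP => i j; rewrite !mxE.
have [->|ij] := eqVneq i j; last by rewrite !mulr0n rmorph0.
by have := Dr j j; rewrite mxE eqxx => /conj_Creal.
Qed.

(** * The Sylvester identity along the flow *)

Section Potential.
Context {R : realType}.
Local Notation C := (cplx R).
Variables (m n : nat) (D B : 'M[C]_m) (A : 'M[C]_n).
Variables (S : R -> 'M[C]_n) (Pi : R -> 'M[C]_(n, m)).
Hypotheses (D_adj : D^t* = D) (DB : D *m B = B *m D).
Hypothesis identity0 : A *m S 0 - S 0 *m A^t* = 'i *: (Pi 0 *m B *m (Pi 0)^t*).
Hypothesis Pi_ode : forall x : R, 0 <= x ->
  is_xderiv [set y | 0 <= y] Pi x (- 'i *: (A *m Pi x *m D)).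
Hypothesis S_ode : forall x : R, 0 <= x ->
  is_xderiv [set y | 0 <= y] S x (Pi x *m D *m B *m (Pi x)^t*).

Lemma Pi_adj_ode x : 0 <= x -> is_xderiv [set y | 0 <= y]
  (fun y => (Pi y)^t*) x ('i *: (D *m (Pi x)^t* *m A^t*)).
Proof.
move=> /Pi_ode /is_xderiv_conjT.
rewrite linearZ /= map_mxZ !trmx_mul !map_mxM /= D_adj mulmxA.
by rewrite rmorphN /= conjCi opprK.
Qed.

(** Both sides have the derivative A Pi D B Pi^* - Pi D B Pi^* A^*; this uses
    that D is self-adjoint and commutes with B. *)
Lemma gram_identity x : 0 <= x ->
  A *m S x - S x *m A^t* = 'i *: (Pi x *m B *m (Pi x)^t*).
Proof.
pose f y := A *m S y + (-1) *: (S y *m A^t*) + (- 'i) *: (Pi y *m B *m (Pi y)^t*).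
move=> x0; have : f x = f 0.
  apply: is_xderiv0_cst x0 => y y0.
  have Piy := Pi_ode y0; have Sy := S_ode y0; have Pi'y := Pi_adj_ode y0.
  have := is_xderivD (is_xderivD (is_xderivMl A Sy)
                        (is_xderivZ (-1) (is_xderivMr (A^t*) Sy)))
    (is_xderivZ (- 'i) (is_xderivM (is_xderivMr B Piy) Pi'y)).
  congr is_xderiv.
  rewrite -!(scalemxAl, scalemxAr) !mulmxA -!(mulmxA _ D B) DB !mulmxA scalerDr !scalerA.
  by rewrite mulrN !mulNr mulCii !opprK scale1r !scaleN1r addrACA subrr addNr addr0.
rewrite /f !scaleN1r !scaleNr identity0 subrr => /eqP.
by rewrite subr_eq0 => /eqP.
Qed.

End Potential.

(** * The Darboux matrix *)

Section Darboux.
Context {R : realType}.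
Local Notation C := (cplx R).
Variables (m n : nat) (D B : 'M[C]_m) (A : 'M[C]_n.+1) (a : C).
Variables (S : R -> 'M[C]_n.+1) (Pi : R -> 'M[C]_(n.+1, m)).

(** The coefficient of (z - a)^-k in I - i B Pi^* S^-1 (A - z)^-1 Pi; the closed
    form is [darboux_mxE].  The expansion is taken as the definition because the
    z-analysis needs it, whereas only the x-derivative uses the closed form. *)
Definition darboux_coef x (k : nat) : 'M[C]_m :=
  if k is k'.+1 then
    'i *: (B *m (Pi x)^t* *m invmx (S x) *m (A - a%:M) ^+ k' *m Pi x)
  else 1%:M.

Definition darboux_mx x (z : C) : 'M[C]_m :=
  \sum_(k < n.+2) (z - a) ^- k *: darboux_coef x k.

Lemma darboux_mxE x z : darboux_mx x z = 1%:M + - 'i *: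
  (B *m (Pi x)^t* *m invmx (S x) *m nilpotent_resolvent (A - a%:M) (z - a) *m Pi x).
Proof.
rewrite /darboux_mx big_ord_recl /= expr0 invr1 scale1r; congr (_ + _).
rewrite /nilpotent_resolvent mulmxN mulNmx scaleNr scalerN opprK.
rewrite mulmx_sumr mulmx_suml scaler_sumr; apply: eq_bigr => k _.
by rewrite -scalemxAr -scalemxAl !scalerA mulrC.
Qed.

Lemma darboux_mx_entryE x i j : (fun z => darboux_mx x z i j)
  = fun z => \sum_(k < n.+2) darboux_coef x k i j * (z - a) ^- k.
Proof.
by apply/funext => z; rewrite summxE; apply: eq_bigr => k _; rewrite mxE mulrC.
Qed.

Hypotheses (D_adj : D^t* = D) (DB : D *m B = B *m D).
Hypothesis A_nilpotent : (A - a%:M) ^+ n.+1 = 0.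
Hypothesis identity0 : A *m S 0 - S 0 *m A^t* = 'i *: (Pi 0 *m B *m (Pi 0)^t*).
Hypothesis Pi_ode : forall x : R, 0 <= x ->
  is_xderiv [set y | 0 <= y] Pi x (- 'i *: (A *m Pi x *m D)).
Hypothesis S_ode : forall x : R, 0 <= x ->
  is_xderiv [set y | 0 <= y] S x (Pi x *m D *m B *m (Pi x)^t*).
Let X := [set x | 0 <= x /\ S x \in unitmx].

Lemma darboux_mx_ode x z : X x -> z != a ->
  let rho := - (B *m (Pi x)^t* *m invmx (S x) *m Pi x) in
  is_xderiv X (darboux_mx ^~ z) x
    ((('i * z) *: D - mx_commutator D rho) *m darboux_mx x z
     - ('i * z) *: (darboux_mx x z *m D)).
Proof.
move=> Xx za rho; have [x0 Sx] := Xx.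
have X_pos : X `<=` [set y | 0 <= y] by move=> y [].
have X_unit : X `<=` [set y | S y \in unitmx] by move=> y [].
have Pi_x := is_xderiv_subset X_pos (Pi_ode x0).
have Pi'_x := is_xderiv_subset X_pos (Pi_adj_ode D_adj Pi_ode x0).
have V_x := is_xderiv_inv X_unit Xx (is_xderiv_subset X_pos (S_ode x0)).
set Q := nilpotent_resolvent (A - a%:M) (z - a).
have za0 : z - a != 0 by rewrite subr_eq0.
have NQ := nilpotent_resolventP A_nilpotent za0.
have QN := nilpotent_resolvent_comm (A - a%:M) (z - a).
rewrite -/Q in NQ QN.
have AQ : A *m Q = 1%:M + z *: Q.
  rewrite -[A in LHS](subrK a%:M) mulmxDl mul_scalar_mx [_ *m Q]NQ.
  by rewrite -addrA -scalerDl subrK.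
have QA : Q *m A = 1%:M + z *: Q.
  rewrite -[A in LHS](subrK a%:M) mulmxDr mul_mx_scalar [_ *m (_ - _)]QN NQ.
  by rewrite -addrA -scalerDl subrK.
have gram := gram_identity D_adj DB identity0 Pi_ode S_ode x0.
have := darboux_identity (mulCii C) Sx DB AQ QA gram.
rewrite -scaleNr -darboux_mxE -/rho => <-.
have W_x := is_xderivD (is_xderiv_cst 1%:M x) (is_xderivZ (- 'i)
  (is_xderivM (is_xderivMr Q (is_xderivM (is_xderivMl B Pi'_x) V_x)) Pi_x)).
rewrite add0r in W_x; move: W_x; congr is_xderiv.
by apply/funext => y; rewrite darboux_mxE.
Qed.

Lemma darboux_mx_holomorphic x : mx_holomorphic [set z | z != a] (darboux_mx x).
Proof.
move=> z za i j; rewrite darboux_mx_entryE.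
exact/ex_derive/(is_derive_laurent _ (fun k => darboux_coef x k i j) id za).
Qed.

(** The operator (t d/dt) (t d/dt + 1) ... (t d/dt + n + 1), with t = z - a,
    acts on the coefficient of t^-k through the factor prod_j (j - k), which
    vanishes for the powers k <= n + 1 that occur here (A has size n + 1). *)
Lemma darboux_mx_annihilator : exists b : nat -> C -> 'M[C]_m,
  [/\ forall l, mx_holomorphic setT (b l),
      forall z, b n.+2 z = ((z - a) ^+ n.+2)%:M
    & forall x z, z != a -> right_op n.+2 b (darboux_mx x) z = 0].
Proof.
have [c [cN cE]] := euler_operator_coef C n.+2.
exists (fun l z => (c l * (z - a) ^+ l)%:M); split.
- move=> l z _ i j; under eq_fun do rewrite mxE mulrb.
  by case: (i == j); [exact: derivable_shift_monomial | exact: derivable_cst].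
- by move=> z; rewrite cN mul1r.
move=> x z za; apply/matrixP => i j; rewrite summxE !mxE.
under eq_bigr => l _.
  rewrite mul_mx_scalar !mxE darboux_mx_entryE.
  rewrite (derive1n_laurent n.+2 (fun k => darboux_coef x k i j)) // mulr_sumr.
  over.
rewrite exchange_big /=; apply: big1 => k _.
have za0 : z - a != 0 by rewrite subr_eq0.
transitivity ((\sum_(l < n.+3) c l * deriv_coef C k l)
              * (darboux_coef x k i j * (z - a) ^- k)).
  rewrite mulr_suml; apply: eq_bigr => l _; rewrite exprD.
  by field; rewrite !expf_neq0.
by rewrite cE (bigD1 k) //= subrr !mul0r.
Qed.

End Darboux.

Theorem proposition3p5 (R : realType) (m n : nat) (D B : 'M[cplx R]_m)
    (A : 'M[cplx R]_n) (lambda : cplx R)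
    (S : R -> 'M[cplx R]_n) (Pi : R -> 'M[cplx R]_(n, m))
    (D_diag : is_diag_mx D) (D_real : D \is a mxOver Num.real)
    (B_diag : is_diag_mx B) (B_sign : forall k, B k k = 1 \/ B k k = -1)
    (A_spectrum : forall a : cplx R, eigenvalue A a <-> a = lambda)
    (S0_selfadjoint : S 0 = (S 0)^t*)
    (identity0 : A *m S 0 - S 0 *m A^t* = 'i *: (Pi 0 *m B *m (Pi 0)^t*))
    (Pi_ode : forall x : R, 0 <= x ->
       is_xderiv [set y | 0 <= y] Pi x (- 'i *: (A *m Pi x *m D)))
    (S_ode : forall x : R, 0 <= x ->
       is_xderiv [set y | 0 <= y] S x (Pi x *m D *m B *m (Pi x)^t*)) :
  bispectral [set x | 0 <= x /\ S x \in unitmx] D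
    (fun x => - (B *m (Pi x)^t* *m invmx (S x) *m Pi x)).
Proof.
(* a matrix of size 0 has no eigenvalue, so n > 0 *)
case: n A S Pi A_spectrum S0_selfadjoint identity0 Pi_ode S_ode => [|k] A S Pi spA.
  have /eigenvalueP[v _] : eigenvalue A lambda by apply/spA.
  by rewrite [v]thinmx0 eqxx.
move=> _ identity0 Pi_ode S_ode.
have nilA := single_eigenvalue_nilpotent (fun b => proj1 (spA b)).
have D_adj := real_diag_mx_adj D_diag D_real.
have DB := diag_mx_commute D_diag B_diag.
have UE : [set z : cplx R | z \notin [:: lambda]] = [set z | z != lambda].
  by apply/funext => z; rewrite /= inE.
exists [:: lambda], (darboux_mx B A lambda S Pi); rewrite UE; split.
- by move=> x z Xx za; exact: darboux_mx_ode.
- by move=> x _; exact: darboux_mx_holomorphic.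
- by move=> x _; exact: det_laurent_neq0.
have [b [b_hol b_lead bW]] := darboux_mx_annihilator B A lambda S Pi.
exists k.+2, b, (fun=> 0); split=> //.
- by move=> l _ z _; exact: b_hol.
(* at t = z - lambda = 1 the leading coefficient is the identity *)
- exists (lambda + 1); first by rewrite /= -subr_eq0 addrC addKr oner_eq0.
  by rewrite b_lead addrC addKr expr1n det1 oner_eq0.
- by move=> x z _ za; rewrite bW // mul0mx.
Qed.
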